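(* Let $(A,\sigma)$ be a real Hermitian algebra, $G=A^\times$, $K=\mathrm{O}(A,\sigma)$, and let $\hat G=\{\hat g\mid g\in G\}$ and $\hat K=\{\hat g\mid g\in K\}$, where $\hat g=\begin{pmatrix} g&0\\0&\sigma(g)^{-1}\end{pmatrix}$. Then the group $\hat G$ acts on the space $\mathfrak{C}_G$ of indefinite involutive almost symplectic operators by conjugation. This action is transitive, and the stabilizer of $J_0=\begin{pmatrix}0&1\\1&0\end{pmatrix}$ is $\hat K$.
   Context: $A$ is a unital associative, possibly noncommutative, finite-dimensional semisimple $\mathbb{R}$-algebra and $\sigma\colon A\to A$ is an anti-involution: $\mathbb{R}$-linear, $\sigma(ab)=\sigma(b)\sigma(a)$, $\sigma^2=\mathrm{Id}$. Put $A^\sigma=\{a\in A\mid\sigma(a)=a\}$, $A^\times$ the group of invertible elements, $\mathrm{O}(A,\sigma)=\{a\in A^\times\mid \sigma(a)=a^{-1}\}$, $A^\sigma_+=\{a^2\mid a\in A^\sigma\cap A^\times\}$, $A^\sigma_{\ge 0}=\{a^2\mid a\in A^\sigma\}$. The pair $(A,\sigma)$ is Hermitian if for $x,y\in A^\sigma$, $x^2+y^2=0$ implies $x=y=0$; as standing properties of Hermitian algebras, $A^\sigma_+$ and $A^\sigma_{\ge0}$ are proper convex cones in $A^\sigma$, $\mathrm{O}(A,\sigma)$ is compact, and $x\mapsto ax\sigma(a)$ preserves $A^\sigma_+$ and $A^\sigma_{\geq 0}$ for every $a\in A^\times$. $A^2$ is the right $A$-module of columns; $x\in A^2$ is regular if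 there is $y\in A^2$ such that $(a,b)\mapsto xa+yb$ is an isomorphism $A^2\to A^2$ of right $A$-modules; an $A$-line is a submodule $xA$ with $x$ regular. For $x,y\in A^2$ let $h(x,y)=\sigma(x)^t\begin{pmatrix}0&1\\1&0\end{pmatrix}y$ and $\omega(x,y)=\sigma(x)^t\begin{pmatrix}0&1\\-1&0\end{pmatrix}y$. A form $b\colon A^2\times A^2\to A$ that is biadditive with $b(xr_1,yr_2)=\sigma(r_1)b(x,y)r_2$ is a $\sigma$-inner product if $b(x,y)=\sigma(b(y,x))$ for all $x,y$, and for all regular $x$, $b(x,x)\in A^\sigma_{\geq0}$, with $b(x,x)=0$ if and only if $x=0$. An $A$-linear $J\colon A^2\to A^2$ is an indefinite involutive operator if $J^2=\mathrm{Id}$ and there are two $A$-lines $l_J^+,l_J^-$ with $J|_{l_J^+}=\mathrm{Id}$, $J|_{l_J^-}=-\mathrm{Id}$. $J$ is almost symplectic if $\omega(J(x),J(y))=-\omega(x,y)$ for all $x,y\in A^2$. $\mathfrak{C}_G$ is the set of all indefinite involutive operators $J$ that are almost symplectic and for which the form $h_J(x,y):=h(J(x),y)$ is a $\sigma$-inner product. *)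

(* Defs.v *)
From HB Require Import structures.
From mathcomp Require Import all_boot all_order all_algebra all_field.
From mathcomp Require Import all_classical all_reals all_analysis.

Set Implicit Arguments.
Unset Strict Implicit.
Unset Printing Implicit Defensive.

Import Order.TTheory GRing.Theory Num.Theory.
Import numFieldNormedType.Exports.

Local Open Scope classical_set_scope.
Local Open Scope ring_scope.

Section Algebra.
Variables (R : realType) (A : falgType R).

Definition left_ideal (I : {vspace A}) : Prop :=
  forall a x : A, x \in I -> a * x \in I.

Definition simple_left_ideal (I : {vspace A}) : Prop :=
  [/\ left_ideal I, I <> 0%VS &
      forall L : {vspace A}, left_ideal L -> (L <= I)%VS -> L = 0%VS \/ L = I].

(* Left ideals of a unital R-algebra are linear subspaces, so ranging over
   [{vspace A}] loses nothing. *)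
Definition semisimple_algebra : Prop :=
  exists (n : nat) (I : 'I_n -> {vspace A}),
    [/\ forall i, simple_left_ideal (I i),
        directv (\sum_(i < n) I i)%VS &
        (\sum_(i < n) I i)%VS = fullv].

Variable sigma : A -> A.

Definition anti_involution : Prop :=
  [/\ linear sigma,
      forall a b : A, sigma (a * b) = sigma b * sigma a &
      forall a : A, sigma (sigma a) = a].

Definition unit_group : set A := [set a | a \is a GRing.unit].

Definition sym_part : set A := [set a | sigma a = a].

Definition sigma_unitary : set A := [set a | unit_group a /\ sigma a = a^-1].

Definition sym_pos : set A := [set a ^+ 2 | a in sym_part `&` unit_group].

Definition sym_nonneg : set A := [set a ^+ 2 | a in sym_part].

Definition hermitian_algebra : Prop :=
  forall x y : A, sym_part x -> sym_part y -> x ^+ 2 + y ^+ 2 = 0 -> x = 0 /\ y = 0.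

(* Proper: the cone contains no affine line. *)
Definition proper_convex_cone (C : set A) : Prop :=
  [/\ forall (t : R) x, 0 < t -> C x -> C (t *: x),
      convex_set (C : set (convex_lmodType A)) &
      forall x v : A, (forall t : R, C (x + t *: v)) -> v = 0].

(* Standing properties of Hermitian algebras. They are not all consequences of
   [hermitian_algebra]: for 2x2 real matrices with sigma the adjugate, the fixed
   elements are the real scalars, but a * x * sigma a = \det a *: x and
   [sigma_unitary] is SL_2(R). Compactness is stated in coordinates because a
   [falgType] carries no topology. *)
Definition hermitian_standing_properties : Prop :=
  [/\ proper_convex_cone sym_pos,
      proper_convex_cone sym_nonneg,
      compact [set passmx.rVof (vbasis {:A}) a | a in sigma_unitary],
      forall a x : A, unit_group a -> sym_pos x -> sym_pos (a * x * sigma a) &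
      forall a x : A, unit_group a -> sym_nonneg x -> sym_nonneg (a * x * sigma a)].

End Algebra.

Section Plane.
Variables (R : realType) (A : falgType R).

Definition mx2 (a b c d : A) : 'M[A]_2 :=
  \matrix_(i, j) if i == 0 then (if j == 0 then a else b)
                 else (if j == 0 then c else d).

(* The library scaling [*:] on 'cV[A]_2 acts on the left. *)
Definition rscale (x : 'cV[A]_2) (a : A) : 'cV[A]_2 := \col_i (x i 0 * a).

Definition right_linear (f : 'cV[A]_2 -> 'cV[A]_2) : Prop :=
  (forall x y, f (x + y) = f x + f y) /\
  (forall x a, f (rscale x a) = rscale (f x) a).

Definition regular_vec (x : 'cV[A]_2) : Prop :=
  exists y : 'cV[A]_2,
    let f := fun c : 'cV[A]_2 => rscale x (c 0 0) + rscale y (c 1 0) in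
    right_linear f /\ bijective f.

Definition A_line (l : set 'cV[A]_2) : Prop :=
  exists2 x, regular_vec x & l = range (rscale x).

Variable sigma : A -> A.

Definition form_of (M : 'M[A]_2) (x y : 'cV[A]_2) : A :=
  ((map_mx sigma x)^T *m M *m y) 0 0.

Definition h_form := form_of (mx2 0 1 1 0).
Definition omega_form := form_of (mx2 0 1 (-1) 0).

Definition sesquilinear (b : 'cV[A]_2 -> 'cV[A]_2 -> A) : Prop :=
  [/\ forall x1 x2 y, b (x1 + x2) y = b x1 y + b x2 y,
      forall x y1 y2, b x (y1 + y2) = b x y1 + b x y2 &
      forall x y r1 r2,
        b (rscale x r1) (rscale y r2) = sigma r1 * b x y * r2].

Definition sigma_inner_product (b : 'cV[A]_2 -> 'cV[A]_2 -> A) : Prop :=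
  [/\ sesquilinear b,
      forall x y, b x y = sigma (b y x) &
      forall x, regular_vec x -> sym_nonneg sigma (b x x) /\ (b x x = 0 <-> x = 0)].

Definition indefinite_involutive (J : 'cV[A]_2 -> 'cV[A]_2) : Prop :=
  [/\ right_linear J,
      forall x, J (J x) = x &
      exists lp lm : set 'cV[A]_2,
        [/\ A_line lp, A_line lm,
            forall x, lp x -> J x = x &
            forall x, lm x -> J x = - x]].

Definition almost_symplectic (J : 'cV[A]_2 -> 'cV[A]_2) : Prop :=
  forall x y, omega_form (J x) (J y) = - omega_form x y.

Definition CG : set ('cV[A]_2 -> 'cV[A]_2) :=
  [set J | [/\ indefinite_involutive J,
               almost_symplectic J &
               sigma_inner_product (fun x y => h_form (J x) y)]].

Definition J0 : 'cV[A]_2 -> 'cV[A]_2 := fun x => mx2 0 1 1 0 *m x.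

Definition hat (g : A) : 'M[A]_2 := mx2 g 0 0 (sigma g)^-1.

Definition hatG : set 'M[A]_2 := [set hat g | g in @unit_group R A].
Definition hatK : set 'M[A]_2 := [set hat g | g in sigma_unitary sigma].

End Plane.

Section Actions.
Variables (R : realType) (A : falgType R).

(* [invmx] requires a commutative base ring. *)
Definition inv2 (M : 'M[A]_2) : 'M[A]_2 :=
  xget 1%:M [set N : 'M[A]_2 | M *m N = 1%:M /\ N *m M = 1%:M].

Definition conj_op (M : 'M[A]_2) (J : 'cV[A]_2 -> 'cV[A]_2) :
    'cV[A]_2 -> 'cV[A]_2 :=
  fun x => M *m J (inv2 M *m x).

Definition matrix_group (H : set 'M[A]_2) : Prop :=
  [/\ H 1%:M,
      forall M N, H M -> H N -> H (M *m N) &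
      forall M, H M ->
        [/\ H (inv2 M), M *m inv2 M = 1%:M & inv2 M *m M = 1%:M]].

Variables (T : Type) (H : set 'M[A]_2) (X : set T) (act : 'M[A]_2 -> T -> T).

Definition acts_on : Prop :=
  [/\ forall M x, H M -> X x -> X (act M x),
      forall x, X x -> act 1%:M x = x &
      forall M N x, H M -> H N -> X x -> act (M *m N) x = act M (act N x)].

Definition transitive_on : Prop :=
  forall x y, X x -> X y -> exists2 M, H M & act M x = y.

Definition stabilizer (x : T) : set 'M[A]_2 := [set M | H M /\ act M x = x].

End Actions.

(* Main.v *)
(* Writing J as a matrix, symmetry of h_J and almost symplecticity together with
   J^2 = 1 force J = [[0, q], [q^-1, 0]]. Evaluating h_J at the second basis vector
   shows q = b^2 with b symmetric and invertible, so J is the conjugate of J_0 by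
   hat b. Conversely h_J(x, x) is then a sum sigma(u) u + sigma(v) v with
   u = b^-1 x_1 and v = b x_2, so one needs
   (1) sigma(a) a >= 0 for every a, which reduces to invertible a by perturbation,
       using that a symmetric element has a minimal polynomial with simple real
       roots, so that the nonnegative cone is closed along the direction 1;
   (2) that sigma(u) u + sigma(v) v = 0 with (u, v) regular gives u = v = 0.
       If sigma(a) a = 0 then (1) applied near a and -a gives sigma(a) = -a; the same
       holds for a c, so sigma(c) a = a c and a^2 = 0, and regularity concludes. *)

Require Import Defs.
From mathcomp Require Import all_boot all_order all_algebra all_field.
From mathcomp Require Import all_classical all_reals all_analysis.
From mathcomp Require Import complex ring.

Set Implicit Arguments.
Unset Strict Implicit.
Unset Printing Implicit Defensive.

Import Order.TTheory GRing.Theory Num.Theory.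

Local Open Scope ring_scope.

(** * Real polynomials: interpolation and splitting *)

Lemma not_uniq_perm (T : eqType) (s : seq T) :
  ~~ uniq s -> exists r t, perm_eq s [:: r, r & t].
Proof.
elim: s => // a s IHs /=; have [a_s _|a_s /IHs [r [t s_rt]]] := boolP (a \in s).
  by exists a, (rem a s); rewrite perm_cons perm_to_rem.
exists r, (a :: t); rewrite -(perm_cons a) in s_rt.
by rewrite (perm_trans s_rt)// (perm_catCA [:: a] [:: r; r] t).
Qed.

(** Newton's scheme: the correction for a new node is a multiple of the product that vanishes at the
    earlier nodes. *)
Lemma interpolation (F : fieldType) (f : F -> F) (rs : seq F) :
  uniq rs -> exists s : {poly F}, {in rs, forall r, s.[r] = f r}.
Proof.
elim: rs => [|a rs IHs] /=; first by exists 0.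
case/andP=> a_rs /IHs [s s_f]; pose q := \prod_(r <- rs) ('X - r%:P).
have qa : q.[a] != 0 by rewrite -/(root q a) root_prod_XsubC.
exists (s + ((f a - s.[a]) / q.[a]) *: q) => r; rewrite inE hornerD hornerZ.
case/predU1P=> [->|r_rs]; first by rewrite mulfVK// addrC subrK.
have /rootP -> : root q r by rewrite root_prod_XsubC.
by rewrite mulr0 addr0 s_f.
Qed.

(** The remainder of p modulo this real quadratic has degree at most 1 and still vanishes at z. Its
    imaginary part there is the slope times Im z, so first the slope and then the constant term are
    zero. *)
Lemma conj_root_dvdp (R : rcfType) (p : {poly R}) (z : R[i]) :
  complex.Im z != 0 -> root (map_poly (real_complex R) p) z ->
  ('X - (complex.Re z)%:P) ^+ 2 + (complex.Im z ^+ 2)%:P %| p.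
Proof.
case: z => a b /= b0 pz; set d := (X in X %| p).
have sd : size d = 3%N.
  by rewrite size_polyDl size_exp_XsubC// (leq_ltn_trans (size_polyC_leq1 _)).
have d0 : d != 0 by rewrite -size_poly_gt0 sd.
have dz : root (map_poly (real_complex R) d) (a +i* b)%C.
  rewrite /root rmorphD/= rmorphXn/= rmorphB/= map_polyX !map_polyC/= !hornerE.
  by rewrite expr2; simpc; rewrite eq_complex /= -expr2 addNr eqxx.
set q := p %% d; have sq : (size q <= 2)%N by rewrite -ltnS -sd ltn_modp.
have qz : root (map_poly (real_complex R) q) (a +i* b)%C.
  move: pz; rewrite {1}(divp_eq p d) rmorphD rmorphM /root hornerD hornerM.
  by move/eqP: dz => ->; rewrite mulr0 add0r.
have qE : q = q`_1 *: 'X + (q`_0)%:P.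
  apply/polyP => -[|[|i]]; rewrite coefD coefZ coefX coefC/= ?mulr0 ?mulr1.
  - by rewrite add0r.
  - by rewrite addr0.
  - by rewrite addr0 nth_default// (leq_trans sq).
move: qz; rewrite qE /root rmorphD/= map_polyZ/= map_polyX map_polyC/= !hornerE.
simpc; rewrite eq_complex /= mulf_eq0 (negbTE b0) orbF => /andP[/eqP q1 /eqP q0].
move: q1; rewrite q0 mul0r add0r => q1.
by rewrite /dvdp -/q qE q0 q1 scale0r add0r.
Qed.

(** Factor over the algebraically closed [R[i]] and take real parts of the roots; injectivity of the
    extension of scalars brings the factorisation back to [R]. *)
Lemma real_rooted_split (R : rcfType) (p : {poly R}) :
  (forall z : R[i], root (map_poly (real_complex R) p) z -> complex.Im z = 0) ->
  exists rs : seq R, p = lead_coef p *: \prod_(r <- rs) ('X - r%:P).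
Proof.
have [->|p0] := eqVneq p 0; first by exists [::]; rewrite lead_coef0 scale0r.
have [zs pE] := closed_field_poly_normal (map_poly (real_complex R) p).
move=> zim; exists (map (@complex.Re R) zs).
apply: (map_poly_inj (real_complex R)).
rewrite [LHS]pE map_polyZ lead_coef_map/= rmorph_prod big_map; congr (_ *: _).
apply: eq_big_seq => z zzs; rewrite rmorphB/= map_polyX map_polyC/=.
congr ('X - _%:P); have /zim : root (map_poly (real_complex R) p) z.
  by rewrite pE rootZ ?root_prod_XsubC// lead_coef_map fmorph_eq0 lead_coef_eq0.
by case: z {zzs} => a b /= ->.
Qed.

(** * Polynomials annihilating an element of a finite-dimensional algebra *)

Section Annihilator.
Variables (R : realType) (A : falgType R).
Implicit Types (x y : A) (p q : {poly R}).

Local Notation ev := horner_alg.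

Lemma horner_alg_comm x p q : ev x p * ev x q = ev x q * ev x p.
Proof. by rewrite -!rmorphM/= mulrC. Qed.

Lemma horner_alg_XsubC x r : ev x ('X - r%:P) = x - r *: 1.
Proof. by rewrite rmorphB/= horner_algX horner_algC. Qed.

Lemma annihilator_exists x : exists2 p : {poly R}, p != 0 & ev x p = 0.
Proof.
pose n := \dim {:A}.
have /freeP : ~~ free [tuple x ^+ i | i < n.+1].
  rewrite /free size_tuple neq_ltn ltnS.
  by apply/orP; left; rewrite dimvS ?subvf.
apply: contra_notP => noann k sumk i.
have ann : ev x (\poly_(j < n.+1) k (inord j)) = 0.
  rewrite poly_def rmorph_sum/= -[RHS]sumk; apply: eq_bigr => j _.
  rewrite linearZ/= rmorphXn/= horner_algX inord_val.
  by rewrite (nth_map ord0) ?size_enum_ord// nth_ord_enum mulr_algl.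
have p0 : \poly_(j < n.+1) k (inord j) = 0.
  by apply/eqP/negPn/negP => p0; apply: noann; exists (\poly_(j < n.+1) k (inord j)).
have := congr1 (fun p : {poly R} => p`_i) p0.
by rewrite coef_poly coef0 ltn_ord inord_val.
Qed.

Definition is_minpoly x p :=
  [/\ p != 0, ev x p = 0 & forall q, ev x q = 0 -> (size q < size p)%N -> q = 0].

Lemma minpoly_exists x : exists p, is_minpoly x p.
Proof.
pose P n := `[< exists p, [/\ p != 0, ev x p = 0 & size p = n] >].
have /ex_minnP [n /asboolP [p [p0 px pn]] minn] : exists n, P n.
  by have [p p0 px] := annihilator_exists x; exists (size p); apply/asboolP; exists p.
exists p; split=> // q qx; rewrite pn; apply: contraTeq => q0.
by rewrite -leqNgt minn//; apply/asboolP; exists q.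
Qed.

(** Write p - p(r) = q (X - r). Evaluating at x, where p vanishes, exhibits -q(x)/p(r) as the
    inverse. *)
Lemma annihilator_unit x p r : ev x p = 0 -> p.[r] != 0 -> x - r *: 1 \is a GRing.unit.
Proof.
move=> px pr; have /factor_theorem [q qE] : root (p - (p.[r])%:P) r.
  by rewrite /root !hornerE subrr.
have qr : ev x q * (x - r *: 1) = - (p.[r] *: 1).
  by rewrite -horner_alg_XsubC -rmorphM/= -qE rmorphB/= px horner_algC sub0r.
apply/unitrP; exists ((- (p.[r])^-1) *: (ev x q)).
rewrite -scalerAl -scalerAr -[in X in _ /\ X]horner_alg_XsubC horner_alg_comm.
by rewrite horner_alg_XsubC qr scaleNr scalerN opprK scalerA mulVf// scale1r.
Qed.

(** The values -e/(k+1) are infinitely many, so one of them is not a root of a nonzero annihilator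
    of x. *)
Lemma unit_shift x (e : R) : 0 < e ->
  exists r, [/\ 0 < r, r <= e & x + r *: 1 \is a GRing.unit].
Proof.
move=> e0; have [p p0 px] := annihilator_exists x.
pose f k : R := - (e / k.+1%:R).
have f_inj : injective f.
  move=> i j /oppr_inj /(mulfI (lt0r_neq0 e0)) /invr_inj /eqP.
  by rewrite eqr_nat eqSS => /eqP.
have [k kp] : exists k, ~~ root p (f k).
  apply: contrapT => /forallNP allr.
  have : (size (mkseq f (size p)) < size p)%N.
    apply: max_poly_roots => //; last by rewrite mkseq_uniq.
    by apply/allP => _ /mapP [k _ ->]; apply/negPn/negP/allr.
  by rewrite size_mkseq ltnn.
exists (e / k.+1%:R); split; first by rewrite divr_gt0.
  by rewrite ler_pdivrMr// ler_peMr ?(ltW e0)// ler1n.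
by have := annihilator_unit px kp; rewrite scaleNr opprK.
Qed.

End Annihilator.

(** * Spectral theory, the nonnegative cone and isotropic elements *)

Section Hermitian.
Variables (R : realType) (A : falgType R) (sigma : A -> A).
Hypothesis sigma_anti : anti_involution sigma.
Hypothesis hermA : hermitian_algebra sigma.
Hypothesis standA : hermitian_standing_properties sigma.
Implicit Types (a b c x y : A) (p q : {poly R}).

Local Notation ev := horner_alg.
Local Notation nonneg := (sym_nonneg sigma).

Lemma sigmaD x y : sigma (x + y) = sigma x + sigma y.
Proof. by case: sigma_anti => l _ _; have := l 1 x y; rewrite !scale1r. Qed.

Lemma sigma0 : sigma 0 = 0.
Proof. by apply: (addrI (sigma 0)); rewrite -sigmaD !addr0. Qed.

Lemma sigmaZ r x : sigma (r *: x) = r *: sigma x.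
Proof. by case: sigma_anti => l _ _; have := l r x 0; rewrite sigma0 !addr0. Qed.

Lemma sigmaN x : sigma (- x) = - sigma x.
Proof. by rewrite -scaleN1r sigmaZ scaleN1r. Qed.

Lemma sigmaM x y : sigma (x * y) = sigma y * sigma x.
Proof. by case: sigma_anti. Qed.

Lemma sigmaK x : sigma (sigma x) = x.
Proof. by case: sigma_anti. Qed.

Lemma sigma1 : sigma 1 = 1.
Proof. by rewrite -[LHS]mulr1 -{2}[1]sigmaK -sigmaM mulr1 sigmaK. Qed.

Lemma sigma_unit x : x \is a GRing.unit -> sigma x \is a GRing.unit.
Proof.
move=> ux; apply/unitrP; exists (sigma x^-1).
by rewrite -!sigmaM mulrV// mulVr// sigma1.
Qed.

Lemma sigmaV x : x \is a GRing.unit -> sigma x^-1 = (sigma x)^-1.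
Proof.
move=> ux; apply: (mulrI (sigma_unit ux)).
by rewrite -sigmaM mulVr// sigma1 mulrV// sigma_unit.
Qed.

Lemma sigma_horner_alg x p : sigma x = x -> sigma (ev x p) = ev x p.
Proof.
move=> sx; elim/poly_ind: p => [|p c IHp]; first by rewrite rmorph0 sigma0.
rewrite rmorphD rmorphM/= horner_algX horner_algC sigmaD sigmaM sigmaZ sigma1 sx IHp.
by rewrite -{1 4}(horner_algX x) horner_alg_comm.
Qed.

Lemma sym_sqr_eq0 x : sigma x = x -> x ^+ 2 = 0 -> x = 0.
Proof.
move=> sx x0; have [|//] := hermA sx (sigma0 : sym_part sigma 0).
by rewrite x0 expr0n addr0.
Qed.

(** Minimality excludes two defects. For a nonreal root, the Hermitian condition would make the
    cofactor of its real quadratic annihilate x. For a repeated root, dropping one copy of its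
    factor leaves a polynomial whose square is a multiple of p, so it would annihilate x too. *)
Lemma minpoly_split x p : sigma x = x -> is_minpoly x p ->
  exists2 rs, uniq rs & p = lead_coef p *: \prod_(r <- rs) ('X - r%:P).
Proof.
move=> sx [p0 px pmin]; have [z pz|rs pE] := @real_rooted_split _ p.
  apply/eqP; apply: contraT => z0; have /dvdpP [v pE] := conj_root_dvdp z0 pz.
  have v0 : v != 0 by apply: contraNneq p0 => v0; rewrite pE v0 mul0r.
  set b := complex.Im z in z0 pE; set a := complex.Re z in pE.
  (* x - a and b * 1 multiplied by v(x) have squares summing to p(x) v(x) = 0. *)
  have vx0 : ev x v = 0.
    have [|||_] := hermA (x := (ev x (('X - a%:P) * v))) (y := (ev x (b *: v))).
    - exact: sigma_horner_alg.
    - exact: sigma_horner_alg.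
    - rewrite -!rmorphXn/= -rmorphD/= -[RHS](mulr0 (ev x v)) -px -rmorphM pE.
      by congr (ev _ _); rewrite -[b *: v]mul_polyC polyC_exp; ring.
    - by rewrite linearZ/= => /eqP; rewrite mulr_algl scaler_eq0 (negbTE z0) => /eqP.
  have := v0; rewrite (pmin v vx0) ?eqxx//.
  rewrite pE size_mul//; last by apply: contraNneq p0 => q0; rewrite pE q0 mulr0.
  rewrite size_polyDl size_exp_XsubC; first by rewrite addn3.
  by rewrite (leq_ltn_trans (size_polyC_leq1 _)).
exists rs => //; apply: contraT => /not_uniq_perm [r [t rs_rt]].
have := pE; rewrite (perm_big _ rs_rt) !big_cons /=.
set w := \prod_(_ <- t) _ => {}pE.
have w0 : ('X - r%:P) * w != 0.
  by rewrite mulf_neq0 ?polyXsubC_eq0// monic_neq0// monic_prod_XsubC.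
have /(pmin _) w1 : ev x (('X - r%:P) * w) = 0.
  apply: sym_sqr_eq0; first exact: sigma_horner_alg.
  rewrite -rmorphXn/=.
  have -> : (('X - r%:P) * w) ^+ 2 = (lead_coef p)^-1 *: (p * w).
    rewrite [X in _ = _ *: (X * w)]pE -scalerAl scalerA mulVf ?lead_coef_eq0//.
    by rewrite scale1r; ring.
  by rewrite linearZ rmorphM/= px mul0r mulr0.
have := w0; rewrite w1 ?eqxx//.
rewrite [p in leqRHS]pE size_scale ?lead_coef_eq0// [leqRHS]size_mul ?polyXsubC_eq0//.
by rewrite size_XsubC.
Qed.

Lemma horner_alg_commr x y p : y * x = x * y -> y * ev x p = ev x p * y.
Proof.
move=> yx; elim/poly_ind: p => [|p c IHp]; first by rewrite rmorph0 mulr0 mul0r.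
rewrite rmorphD rmorphM/= horner_algX horner_algC mulrDr mulrDl mulrA IHp -!mulrA.
by rewrite yx -scalerAl -scalerAr mul1r mulr1.
Qed.

(** Here [rs] is the spectrum of x. The first clause yields nonnegativity from values on the
    spectrum; the second provides the eigen-elements used to refute a negative spectral value. *)
Lemma spectral x : sigma x = x -> exists rs : seq R,
  (forall p, {in rs, forall r, 0 <= p.[r]} -> nonneg (ev x p)) /\
  {in rs, forall r, exists e, [/\ sigma e = e, e != 0, x * e = r *: e &
                               forall y, y * x = x * y -> y * e = e * y]}.
Proof.
move=> sx; have [p pmin] := minpoly_exists x.
have [rs rs_uniq pE] := minpoly_split sx pmin; case: pmin => p0 px pmin.
have lp0 : lead_coef p != 0 by rewrite lead_coef_eq0.
exists rs; split=> [q q_ge0|r r_rs].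
  (* Interpolating the square roots of q on the spectrum makes s^2 - q a multiple of the minimal
     polynomial, so s(x)^2 = q(x). *)
  have [s sE] := interpolation (fun r => Num.sqrt q.[r]) rs_uniq.
  have /dvdpP [v vE] : \prod_(r <- rs) ('X - r%:P) %| s ^+ 2 - q.
    rewrite uniq_roots_dvdp ?uniq_rootsE//; apply/allP => r r_rs.
    by rewrite /root hornerD hornerN horner_exp sE// sqr_sqrtr ?q_ge0// subrr.
  exists (ev x s); first exact: sigma_horner_alg.
  apply/eqP; rewrite -subr_eq0 -rmorphXn -rmorphB/= vE.
  have -> : v * \prod_(r <- rs) ('X - r%:P) = (lead_coef p)^-1 *: (v * p).
    by rewrite [X in _ = _ *: (v * X)]pE -scalerAr scalerA mulVf// scale1r.
  by rewrite linearZ rmorphM/= px !mulr0.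
(* Without its factor at r, the minimal polynomial gives a nonzero multiple of the spectral
   projection at r. *)
pose w := \prod_(a <- rem r rs) ('X - a%:P).
have pw : p = lead_coef p *: (('X - r%:P) * w).
  by rewrite [LHS]pE (big_rem r r_rs).
have w0 : w != 0 by rewrite monic_neq0// monic_prod_XsubC.
exists (ev x w); split.
- exact: sigma_horner_alg.
- apply/eqP => /pmin; rewrite pw size_scale// size_mul ?polyXsubC_eq0// size_XsubC.
  by move=> /(_ (ltnSn _)) /eqP; rewrite (negbTE w0).
- apply/eqP; rewrite -subr_eq0 -[r *: _]mul1r -scalerAr scalerAl -mulrBl.
  rewrite -horner_alg_XsubC -rmorphM/= -[X in ev x X](scalerK lp0) -pw.
  by rewrite linearZ/= px mulr0.
- by move=> y; apply: horner_alg_commr.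
Qed.

Lemma nonneg_sym x : nonneg x -> sigma x = x.
Proof. by case=> u su <-; rewrite expr2 sigmaM su. Qed.

Lemma nonnegZ r x : 0 <= r -> nonneg x -> nonneg (r *: x).
Proof.
move=> r0 [u su <-]; exists (Num.sqrt r *: u).
  by rewrite /sym_part/= sigmaZ su.
by rewrite exprZn sqr_sqrtr.
Qed.

Lemma nonnegD x y : nonneg x -> nonneg y -> nonneg (x + y).
Proof.
move=> x0 y0; have [_ [_ cvx _] _ _ _] := standA.
have h0 : 0 <= 2^-1 :> R by rewrite invr_ge0.
have h1 : 2^-1 <= 1 :> R by rewrite invf_le1// ler1n.
(* The sum x + y is the midpoint of 2x and 2y. *)
have := cvx (2 *: x) (2 *: y) (Itv01 h0 h1).
rewrite !inE => /(_ (nonnegZ _ x0) (nonnegZ _ y0)).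
have -> : conv (Itv01 h0 h1) (2 *: x : convex_lmodType A) (2 *: y) =
    2^-1 *: (2 *: x) + (1 - 2^-1) *: (2 *: y) by [].
have -> : 1 - 2^-1 = 2^-1 :> R by rewrite {1}[1]splitr mul1r addrK.
by rewrite !scalerA mulVf ?pnatr_eq0// !scale1r; apply; exact: ler0n.
Qed.

Lemma nonneg_unit a : a \is a GRing.unit -> nonneg (sigma a * a).
Proof.
move=> ua; have [_ _ _ pos _] := standA.
have [|u [su _] uE] := pos (sigma a) 1 (sigma_unit ua).
  by exists 1; rewrite ?expr1n//; split; [exact: sigma1|exact: unitr1].
by exists u; rewrite // uE mulr1 sigmaK.
Qed.

Lemma sym_bounded x : sigma x = x -> exists2 K : R, 0 < K & nonneg (K *: 1 - x).
Proof.
move=> /spectral [rs [nn _]]; pose K : R := 1 + \sum_(r <- rs) `|r|.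
exists K; first by rewrite ltr_pwDl// sumr_ge0.
rewrite -(horner_algC x) -{2}(horner_algX x) -rmorphB; apply: nn => r r_rs.
rewrite !hornerE subr_ge0 (le_trans (ler_norm r))// /K (big_rem r r_rs)/=.
by rewrite addrCA lerDl addr_ge0// sumr_ge0.
Qed.

(** Suppose c has a spectral value r < 0 with eigen-element e, and write c - r/2 = u^2. Since u
    commutes with c it commutes with e, and (u e)^2 = (r/2) e^2. Adding the square of sqrt(-r/2) e
    gives 0, so the Hermitian condition forces e = 0. *)
Lemma nonneg_closed c : (forall d : R, 0 < d -> nonneg (c + d *: 1)) -> nonneg c.
Proof.
move=> cd; have sc : sigma c = c.
  have := nonneg_sym (cd 1 ltr01).
  by rewrite sigmaD sigmaZ sigma1 => /addIr.
have [rs [nn eig]] := spectral sc.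
rewrite -(horner_algX c); apply: nn => r r_rs; rewrite hornerX leNgt.
apply/negP => r_lt0; have [e [se e0 ce e_comm]] := eig r r_rs.
have d_gt0 : 0 < - r / 2 by rewrite divr_gt0// oppr_gt0.
have [u su uE] := cd _ d_gt0.
have uc : u * c = c * u.
  have -> : c = u ^+ 2 - (- r / 2) *: 1 by rewrite uE addrK.
  by rewrite mulrBr mulrBl -exprS -exprSr -scalerAl -scalerAr mul1r mulr1.
have ue := e_comm u uc.
have [|||_] := hermA (x := u * e) (y := Num.sqrt (- r / 2) *: e).
- by rewrite /sym_part/= sigmaM su se ue.
- by rewrite /sym_part/= sigmaZ se.
- rewrite exprZn sqr_sqrtr ?ltW// (exprMn_comm 2 ue) uE mulrDl.
  rewrite [e ^+ 2]expr2 mulrA ce -!scalerAl mul1r -!scalerDl -[_ + _]/(_ + _).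
  suff -> : r + - r / 2 + - r / 2 = 0 by rewrite scale0r.
  by rewrite -addrA -splitr addrN.
- by apply/eqP; rewrite scaler_eq0 negb_or e0 sqrtr_eq0 -ltNge d_gt0.
Qed.

Lemma sigma_shift a (e : R) : sigma (a + e *: 1) * (a + e *: 1) =
  sigma a * a + e *: (a + sigma a) + (e ^+ 2) *: 1.
Proof.
rewrite sigmaD sigmaZ sigma1 mulrDl !mulrDr -!scalerAl -!scalerAr !mul1r mulr1.
by rewrite scalerA scalerDr expr2 !addrA [_ + e *: sigma a + e *: a]addrAC.
Qed.

(* With t = a + sigma a and K - t >= 0, sigma a * a + d is the sum of
   sigma (a + e) * (a + e), e (K - t) and the scalar d - e^2 - e K, all nonnegative
   for a small e > 0 making a + e invertible. *)
Lemma nonneg_sqr a : nonneg (sigma a * a).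
Proof.
have st : sigma (a + sigma a) = a + sigma a by rewrite sigmaD sigmaK addrC.
have [K K0 aK] := sym_bounded st.
apply: nonneg_closed => d d0.
(* The bound e <= 1 gives e^2 <= e, hence e^2 + e K <= e (K + 1) <= d. *)
have b0 : 0 < Num.min 1 (d / (K + 1)).
  by rewrite lt_min ltr01 divr_gt0// addr_gt0.
have [e [e0]] := unit_shift a b0; rewrite le_min => /andP[e1].
rewrite ler_pdivlMr ?addr_gt0// => ed /nonneg_unit; rewrite sigma_shift => ae.
have -> : sigma a * a + d *: 1 =
    (sigma a * a + e *: (a + sigma a) + (e ^+ 2) *: 1)
    + e *: (K *: 1 - (a + sigma a)) + (d - e ^+ 2 - e * K) *: 1.
  rewrite -3!addrA; congr (_ + _); rewrite scalerBr scalerA !scalerBl.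
  rewrite [X in _ + (_ + X)]addrC subrKA addrCA.
  rewrite [X in _ + X]addrC subrK addrC subrK //.
apply: nonnegD; first by apply: nonnegD => //; apply: nonnegZ => //; exact: ltW.
apply: nonnegZ; last by exists 1; rewrite ?expr1n//; exact: sigma1.
rewrite -addrA -opprD subr_ge0 (le_trans _ ed)// mulrDr mulr1 addrC lerD2l.
by rewrite expr2 ler_piMl// ltW.
Qed.

(* Here sigma (a + e) * (a + e) = e (a + sigma a + e), which is nonnegative for
   arbitrarily small e > 0. *)
Lemma trace_nonneg a : sigma a * a = 0 -> nonneg (a + sigma a).
Proof.
move=> a0; apply: nonneg_closed => d d0.
have [e [e0 ed /nonneg_unit]] := unit_shift a d0.
rewrite sigma_shift a0 add0r => /(@nonnegZ e^-1 _ _).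
rewrite scalerDr !scalerA mulVf ?gt_eqF// scale1r expr2 mulKf ?gt_eqF// => ae.
have -> : a + sigma a + d *: 1 = a + sigma a + e *: 1 + (d - e) *: 1.
  by rewrite -[RHS]addrA -scalerDl [e + _]addrC subrK.
apply: nonnegD; first by apply: ae; rewrite invr_ge0 ltW.
apply: nonnegZ; first by rewrite subr_ge0.
by exists 1; rewrite ?expr1n//; exact: sigma1.
Qed.

(** Both a + sigma(a) and its negative are squares of symmetric elements, and these squares sum to
    0. *)
Lemma isotropic_skew a : sigma a * a = 0 -> sigma a = - a.
Proof.
move=> a0; have [u su uE] := trace_nonneg a0.
have [|v sv vE] := @trace_nonneg (- a); first by rewrite sigmaN mulrNN.
have [|u0 _] := hermA su sv; first by rewrite uE vE sigmaN -opprD addrN.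
by apply/eqP; rewrite -addr_eq0 addrC -uE u0 expr0n.
Qed.

(** The product a b is again isotropic, so both a and a b are skew; compare the two expressions for
    sigma(a b). *)
Lemma isotropic_swap a b : sigma a * a = 0 -> sigma b * a = a * b.
Proof.
move=> a0; apply: oppr_inj; rewrite -mulrN -(isotropic_skew a0) -sigmaM.
by apply: isotropic_skew; rewrite sigmaM -mulrA (mulrA (sigma a)) a0 mul0r mulr0.
Qed.

Lemma isotropic_sqr a : sigma a * a = 0 -> a * a = 0.
Proof.
move=> a0; have := a0; rewrite (isotropic_skew a0) mulNr => /eqP.
by rewrite oppr_eq0 => /eqP.
Qed.

(** Both summands are squares of symmetric elements, so each vanishes. The swap rule and skewness
    then make all four products of a and b zero, and the cancellation hypothesis applies to a and to
    b themselves. *)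
Lemma isotropic_pair a b : sigma a * a + sigma b * b = 0 ->
  (forall c, a * c = 0 -> b * c = 0 -> c = 0) -> a = 0 /\ b = 0.
Proof.
move=> ab0 inj.
have [u su uE] := nonneg_sqr a; have [v sv vE] := nonneg_sqr b.
have [u0 v0] : u = 0 /\ v = 0 by apply: hermA => //; rewrite uE vE.
have a0 : sigma a * a = 0 by rewrite -uE u0 expr0n.
have b0 : sigma b * b = 0 by rewrite -vE v0 expr0n.
have aa := isotropic_sqr a0; have bb := isotropic_sqr b0.
have ba : b * a = 0.
  apply: inj; last by rewrite mulrA bb mul0r.
  by rewrite mulrA -(isotropic_swap b a0) -mulrA aa mulr0.
have ab : a * b = 0.
  by rewrite -(isotropic_swap b a0) (isotropic_skew b0) mulNr ba oppr0.
by split; apply: inj.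
Qed.

End Hermitian.

(** * Columns and 2x2 matrices over a noncommutative ring *)

Section Plane.
Variables (R : realType) (A : falgType R).
Implicit Types (a b c d : A).

Definition col2 a b : 'cV[A]_2 := \col_i (if i == 0 then a else b).

Definition antidiag a : 'M[A]_2 := mx2 0 a a^-1 0.

Lemma col2E (x : 'cV[A]_2) : x = col2 (x 0 0) (x 1 0).
Proof.
apply/matrixP => i j; rewrite !mxE ord1.
by case: i => -[|[|//]] ? /=; congr (x _ _); apply: val_inj.
Qed.

Lemma col2_inj a b c d : col2 a b = col2 c d -> a = c /\ b = d.
Proof. by move/colP => e; split; [have := e 0|have := e 1]; rewrite !mxE. Qed.

Lemma col2D a b c d : col2 a b + col2 c d = col2 (a + c) (b + d).
Proof. by apply/colP => i; rewrite !mxE; case: ifP. Qed.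

Lemma col2N a b : - col2 a b = col2 (- a) (- b).
Proof. by apply/colP => i; rewrite !mxE; case: ifP. Qed.

Lemma rscale_col2 a b c : rscale (col2 a b) c = col2 (a * c) (b * c).
Proof. by apply/colP => i; rewrite !mxE; case: ifP. Qed.

Lemma mul_mx2_col2 a b c d x y :
  mx2 a b c d *m col2 x y = col2 (a * x + b * y) (c * x + d * y).
Proof. by apply/colP => i; rewrite !mxE !big_ord_recr big_ord0/= !mxE/= add0r; case: ifP. Qed.

Lemma mul_mx2 a b c d a' b' c' d' : mx2 a b c d *m mx2 a' b' c' d' =
  mx2 (a * a' + b * c') (a * b' + b * d') (c * a' + d * c') (c * b' + d * d').
Proof.
by apply/matrixP => i j; rewrite !mxE !big_ord_recr big_ord0/= !mxE/= add0r; do ?case: ifP.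
Qed.

Lemma mx2_1 : mx2 1 0 0 1 = 1%:M :> 'M[A]_2.
Proof. by apply/matrixP => -[[|[|//]] ?] [[|[|//]] ?]; rewrite !mxE. Qed.

Lemma inv2_unique (M N : 'M[A]_2) : M *m N = 1%:M -> N *m M = 1%:M -> inv2 M = N.
Proof.
move=> MN NM; rewrite /inv2; case: xgetP => [N' _ [MN' N'M]|/(_ N)/=]; last by case.
by rewrite -[N']mulmx1 -MN mulmxA N'M mul1mx.
Qed.

Lemma regular_vec_inj (x : 'cV[A]_2) c : regular_vec x -> rscale x c = 0 -> c = 0.
Proof.
case=> y [_ /bij_inj f_inj] xc0.
have /f_inj /col2_inj [//] : rscale x (col2 c 0 0 0) + rscale y (col2 c 0 1 0) =
          rscale x (col2 0 0 0 0) + rscale y (col2 0 0 1 0).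
by rewrite !mxE/= xc0; congr (_ + _); apply/colP => i; rewrite !mxE mulr0.
Qed.

(** The second column of the invertible matrix completes the first one to a basis. *)
Lemma regular_vecP a b c d a' b' c' d' :
  mx2 a b c d *m mx2 a' b' c' d' = 1%:M -> mx2 a' b' c' d' *m mx2 a b c d = 1%:M ->
  regular_vec (col2 a c).
Proof.
move=> MN NM; exists (col2 b d).
have -> : (fun x : 'cV[A]_2 =>
            rscale (col2 a c) (x 0 0) + rscale (col2 b d) (x 1 0)) =
          mulmx (mx2 a b c d).
  by apply/funext => x; rewrite [in RHS](col2E x) mul_mx2_col2 !rscale_col2 col2D.
split; last first.
  by exists (mulmx (mx2 a' b' c' d')) => x; rewrite mulmxA ?MN ?NM mul1mx.
split=> [x y|x r]; first exact: mulmxDr.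
by rewrite (col2E x) rscale_col2 !mul_mx2_col2 rscale_col2 !mulrDl !mulrA.
Qed.

End Plane.

(** * Almost symplectic operators as antidiagonal matrices *)

Section Operators.
Variables (R : realType) (A : falgType R) (sigma : A -> A).
Hypothesis sigma_anti : anti_involution sigma.
Hypothesis hermA : hermitian_algebra sigma.
Hypothesis standA : hermitian_standing_properties sigma.
Implicit Types (a b c d g q : A).

Local Notation antiop q := (mulmx (antidiag q) : 'cV[A]_2 -> 'cV[A]_2).
Local Notation sD := (sigmaD sigma_anti).
Local Notation sN := (sigmaN sigma_anti).
Local Notation sM := (sigmaM sigma_anti).
Local Notation sK := (sigmaK sigma_anti).
Local Notation s0 := (sigma0 sigma_anti).
Local Notation s1 := (sigma1 sigma_anti).

Lemma antiop_col2 q a b : antiop q (col2 a b) = col2 (q * b) (q^-1 * a).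
Proof. by rewrite mul_mx2_col2 !mul0r add0r addr0. Qed.

Lemma form_of_col2 m11 m12 m21 m22 a b c d :
  form_of sigma (mx2 m11 m12 m21 m22) (col2 a b) (col2 c d) =
  (sigma a * m11 + sigma b * m21) * c + (sigma a * m12 + sigma b * m22) * d.
Proof.
rewrite /form_of !mxE !big_ord_recr big_ord0/= !mxE !big_ord_recr !big_ord0/=.
by rewrite !mxE/= !add0r.
Qed.

Lemma h_form_col2 a b c d :
  h_form sigma (col2 a b) (col2 c d) = sigma b * c + sigma a * d.
Proof. by rewrite /h_form form_of_col2 !mulr0 !mulr1 add0r addr0. Qed.

Lemma omega_form_col2 a b c d :
  omega_form sigma (col2 a b) (col2 c d) = sigma a * d - sigma b * c.
Proof. by rewrite /omega_form form_of_col2 !mulr0 mulr1 mulrN1 add0r addr0 mulNr addrC. Qed.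

Lemma antiop_CG b : sigma b = b -> b \is a GRing.unit -> CG sigma (antiop (b ^+ 2)).
Proof.
move=> sb ub.
have sbV : sigma b^-1 = b^-1 by rewrite (sigmaV sigma_anti ub) sb.
have half : (2^-1 : R) + 2^-1 = 1 by rewrite [RHS]splitr mul1r.
have JE x y : antiop (b ^+ 2) (col2 x y) = col2 (b * (b * y)) (b^-1 * (b^-1 * x)).
  by rewrite antiop_col2 expr2 invrM// !mulrA.
have hE x y : h_form sigma (antiop (b ^+ 2) x) y =
    sigma (b^-1 * x 0 0) * (b^-1 * y 0 0) + sigma (b * x 1 0) * (b * y 1 0).
  rewrite {1}(col2E x) {1}(col2E y) JE h_form_col2 !sM sb sbV.
  by rewrite !mulrA.
split.
- split.
  + split=> [x y|x a]; first exact: mulmxDr.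
    by rewrite (col2E x) rscale_col2 !JE rscale_col2 !mulrA.
  + by move=> x; rewrite (col2E x) !JE mulKr// mulKr// mulVKr// mulVKr.
  pose h : A := 2^-1 *: 1.
  have hh : h + h = 1 by rewrite /h -scalerDl half scale1r.
  have hC a : h * a = a * h by rewrite /h -scalerAl -scalerAr mul1r mulr1.
  (* The eigenlines for 1 and -1 are spanned by (b, b^-1) and (b, -b^-1). [P] and [Q] invert the
     matrices having these vectors as columns, in the two orders, so both vectors are regular. *)
  pose P : 'M[A]_2 := mx2 (h * b^-1) (h * b) (h * b^-1) (- (h * b)).
  pose Q : 'M[A]_2 := mx2 (h * b^-1) (- (h * b)) (h * b^-1) (h * b).
  have regp : mx2 b b b^-1 (- b^-1) *m P = 1%:M.
    rewrite mul_mx2 !mulrN !mulNr !opprK !subrr !mulrA -!hC -!mulrA.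
    by rewrite mulrV// mulVr// !mulr1 hh mx2_1.
  have regm : P *m mx2 b b b^-1 (- b^-1) = 1%:M.
    rewrite mul_mx2 !mulrN !mulNr !opprK -!mulrA.
    by rewrite mulrV// mulVr// !mulr1 hh subrr mx2_1.
  have regm1 : mx2 b b (- b^-1) b^-1 *m Q = 1%:M.
    rewrite mul_mx2 !mulrN !mulNr !opprK !addNr !mulrA -!hC -!mulrA.
    by rewrite mulrV// mulVr// !mulr1 hh mx2_1.
  have regm2 : Q *m mx2 b b (- b^-1) b^-1 = 1%:M.
    rewrite mul_mx2 !mulrN !mulNr !opprK -!mulrA.
    by rewrite mulrV// mulVr// !mulr1 hh subrr mx2_1.
  exists (range (rscale (col2 b b^-1))), (range (rscale (col2 b (- b^-1)))).
  split.
  + by exists (col2 b b^-1) => //; apply: regular_vecP regp regm.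
  + by exists (col2 b (- b^-1)) => //; apply: regular_vecP regm1 regm2.
  + by move=> _ [a _ <-]; rewrite rscale_col2 JE mulVKr// mulKr.
  + move=> _ [a _ <-]; rewrite rscale_col2 JE col2N mulNr !mulrN opprK.
    by rewrite mulVKr// mulKr.
- move=> x y; rewrite (col2E x) (col2E y) !JE !omega_form_col2 opprB !sM sb sbV.
  by rewrite !mulrA !(mulrVK, mulrK)//.
- split.
  + split=> [x1 x2 y|x y1 y2|x y r1 r2]; rewrite !hE !mxE.
    * by rewrite !mulrDr !sD !mulrDl addrACA.
    * by rewrite !mulrDr addrACA.
    * by rewrite mulrDr mulrDl !sM !mulrA.
  + by move=> x y; rewrite !hE sD !sM !sK !mulrA.
  + move=> x xreg; rewrite hE; split.
      by apply: nonnegD => //; apply: nonneg_sqr.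
    (* The cancellation hypothesis comes from regularity: if b^-1 x_1 c = 0 and b x_2 c = 0, then x
       c = 0 and so c = 0. *)
    split=> [/(isotropic_pair sigma_anti hermA standA) [c|x0 x1]|->].
    * rewrite -!mulrA => x0 x1; apply: regular_vec_inj xreg _.
      rewrite (col2E x) rscale_col2 -(mulVKr ub (_ * c)) x0.
      rewrite -[x 1 0 * c](mulKr ub) x1 !mulr0.
      by apply/colP => i; rewrite !mxE; case: ifP.
    * rewrite (col2E x) -[x 0 0](mulVKr ub) x0 -[x 1 0](mulKr ub) x1 !mulr0.
      by apply/colP => i; rewrite !mxE; case: ifP.
    * by rewrite !mxE !mulr0 addr0.
Qed.

Lemma regular_vec_e1 : regular_vec (col2 1 0 : 'cV[A]_2).
Proof. by apply: (@regular_vecP _ _ 1 0 0 1 1 0 0 1); rewrite mx2_1 mul1mx. Qed.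

Lemma regular_vec_e2 : regular_vec (col2 0 1 : 'cV[A]_2).
Proof.
apply: (@regular_vecP _ _ 0 1 1 0 0 1 1 0).
all: by rewrite mul_mx2 !mulr0 !mulr1 !add0r !addr0 mx2_1.
Qed.

(** For J = [[p, q], [r, s]], all relations come from evaluating the hypotheses at the two basis
    vectors. They make the diagonal vanish and q, r mutually inverse. *)
Lemma CG_antiop J : CG sigma J ->
  exists b, [/\ sigma b = b, b \is a GRing.unit & J = antiop (b ^+ 2)].
Proof.
case=> -[[JD JZ] JJ _] Jomega [_ Jsym Jpos].
pose p := J (col2 1 0) 0 0; pose r := J (col2 1 0) 1 0.
pose q := J (col2 0 1) 0 0; pose s := J (col2 0 1) 1 0.
have JE a b : J (col2 a b) = col2 (p * a + q * b) (r * a + s * b).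
  have -> : col2 a b = rscale (col2 1 0) a + rscale (col2 0 1) b.
    by rewrite !rscale_col2 col2D !mul1r !mul0r addr0 add0r.
  by rewrite JD !JZ [J (col2 1 0)]col2E [J (col2 0 1)]col2E !rscale_col2 col2D.
pose simp := (mulr1, mulr0, mul1r, mul0r, addr0, add0r, s0, s1, subr0, sub0r, oppr0).
have ps : sigma p = s.
  by have := Jsym (col2 1 0) (col2 0 1); rewrite !JE !h_form_col2 !simp sK.
have [[b sb bE] _] := Jpos _ regular_vec_e2.
have sr : sigma r = r.
  have [/nonneg_sym + _] := Jpos _ regular_vec_e1.
  by rewrite !JE !h_form_col2 !simp sK => /(_ sigma_anti).
move: bE; rewrite JE h_form_col2 !simp => bq.
have sq : sigma q = q by rewrite -[RHS]sK -bq expr2 sM sb.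
have om12 : s * s - r * q = - 1.
  by have := Jomega (col2 1 0) (col2 0 1); rewrite !JE !omega_form_col2 !simp ps sr.
have om11 : s * r - r * p = 0.
  by have := Jomega (col2 1 0) (col2 1 0); rewrite !JE !omega_form_col2 !simp ps sr.
have /col2_inj [pp rp] : col2 (p * p + q * r) (r * p + s * r) = col2 1 0.
  by rewrite -[RHS]JJ JE JE !simp.
have /col2_inj [_ ss] : col2 (p * q + q * s) (r * q + s * s) = col2 0 1.
  by rewrite -[RHS]JJ JE JE !simp.
have double0 (a : A) : a + a = 0 -> a = 0.
  rewrite -mulr2n -scaler_nat => /eqP.
  by rewrite scaler_eq0 pnatr_eq0/= => /eqP.
(* Almost symplecticity gives r q - s^2 = 1, while J^2 = 1 gives r q + s^2 = 1. *)
have ss0 : s * s = 0.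
  apply: double0; rewrite -{1}[s * s](subrK (r * q)) om12.
  by rewrite -addrA ss addNr.
have rq : r * q = 1 by move: ss; rewrite ss0 addr0.
have pp0 : p * p = 0 by rewrite -[LHS]sK sM ps ss0 s0.
have qr : q * r = 1 by move: pp; rewrite pp0 add0r.
(* Here s r = r p from [om11], and r p + s r = 0 from J^2 = 1. *)
have rp0 : r * p = 0.
  by apply: double0; move/eqP: om11; rewrite subr_eq0 => /eqP om11; rewrite -{2}om11.
have p0 : p = 0 by rewrite -[p]mul1r -qr -mulrA rp0 mulr0.
have s_0 : s = 0 by rewrite -ps p0 s0.
have uq : q \is a GRing.unit by apply/unitrP; exists r.
exists b; rewrite bq sq; split=> //.
  by rewrite -(unitrX_pos b (ltn0Sn 1)) bq sq.
have rV : r = q^-1 by rewrite -[RHS]mul1r -rq mulrK.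
by apply/funext => x; rewrite (col2E x) JE antiop_col2 p0 s_0 rV !simp.
Qed.

(** * The conjugation action of the diagonal group *)

Lemma mul_hat g h : g \is a GRing.unit -> h \is a GRing.unit ->
  hat sigma g *m hat sigma h = hat sigma (g * h).
Proof.
move=> ug uh; rewrite /hat mul_mx2 !mulr0 !mul0r !addr0 !add0r sM invrM//.
all: exact: sigma_unit.
Qed.

Lemma hat1 : hat sigma 1 = 1%:M.
Proof. by rewrite /hat s1 invr1 mx2_1. Qed.

Lemma mul_hatV g : g \is a GRing.unit ->
  hat sigma g *m hat sigma g^-1 = 1%:M /\ hat sigma g^-1 *m hat sigma g = 1%:M.
Proof. by move=> ug; rewrite !mul_hat ?unitrV// mulrV// mulVr// hat1. Qed.

Lemma inv2_hat g : g \is a GRing.unit -> inv2 (hat sigma g) = hat sigma g^-1.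
Proof. by move=> /mul_hatV [gV Vg]; apply: inv2_unique. Qed.

(** This reduces conjugation of operators to the congruence action of units on the entry q; the
    action, transitivity and stabilizer claims are then read off in [A]. *)
Lemma conj_hat_antiop g q : g \is a GRing.unit -> q \is a GRing.unit ->
  conj_op (hat sigma g) (antiop q) = antiop (g * q * sigma g).
Proof.
move=> ug uq; apply/funext => x; have us := sigma_unit sigma_anti ug.
rewrite /conj_op inv2_hat// !mulmxA; congr (_ *m x).
rewrite !mul_mx2 !(mulr0, mul0r, addr0, add0r) (sigmaV sigma_anti)// invrK.
have ugq : g * q \is a GRing.unit by rewrite unitrMl.
by rewrite /antidiag (invrM ugq us) (invrM ug uq) mulrA.
Qed.

Lemma antiop_inj q q' : antiop q = antiop q' -> q = q'.
Proof.
move/(congr1 (fun f => f (col2 0 1))); rewrite !antiop_col2 !mulr1.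
by case/col2_inj.
Qed.

Lemma J0E : @J0 R A = antiop 1.
Proof. by rewrite /J0 /antidiag invr1. Qed.

Lemma matrix_group_hatG : matrix_group (hatG sigma).
Proof.
split=> [|_ _ [g ug <-] [h uh <-]|_ [g ug <-]].
- by exists 1; [exact: unitr1|exact: hat1].
- by exists (g * h); [rewrite /unit_group/= unitrMl|rewrite mul_hat].
- have [gV Vg] := mul_hatV ug; rewrite inv2_hat//; split=> //.
  by exists g^-1 => //; rewrite /unit_group/= unitrV.
Qed.

Lemma acts_on_hatG : acts_on (hatG sigma) (CG sigma) (@conj_op R A).
Proof.
split=> [_ _ [g ug <-] /CG_antiop [b [sb ub ->]]|J _|_ _ J [g ug <-] [h uh <-] _].
- rewrite conj_hat_antiop ?unitrX//; have [_ _ _ pos _] := standA.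
  (* The cone of squares of symmetric units is stable under congruence, so the new entry is again
     such a square. *)
  have [|c [sc uc] <-] := pos g (b ^+ 2) ug; first by exists b.
  exact: antiop_CG.
- apply/funext => x; rewrite /conj_op -hat1 inv2_hat ?unitr1// invr1 hat1.
  by rewrite !mul1mx.
- apply/funext => x; rewrite /conj_op mul_hat// !inv2_hat ?unitrMl//.
  by rewrite invrM// -!mul_hat ?unitrV// !mulmxA.
Qed.

Lemma transitive_on_hatG : transitive_on (hatG sigma) (CG sigma) (@conj_op R A).
Proof.
move=> _ _ /CG_antiop [b [sb ub ->]] /CG_antiop [c [sc uc ->]].
(* With g = c b^-1, the congruence sends b^2 to c b^-1 b^2 b^-1 c = c^2. *)
have ug : c * b^-1 \is a GRing.unit by rewrite unitrMl ?unitrV.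
exists (hat sigma (c * b^-1)); first by exists (c * b^-1).
rewrite conj_hat_antiop ?unitrX// sM (sigmaV sigma_anti ub) sb sc; congr mulmx.
by congr antidiag; rewrite !expr2 !mulrA mulrVK// mulrK.
Qed.

(** Since [J0] has entry q = 1, the unit g fixes it exactly when g sigma(g) = 1. *)
Lemma stabilizer_J0 :
  stabilizer (hatG sigma) (@conj_op R A) (@J0 R A) = hatK sigma.
Proof.
rewrite J0E; apply/seteqP; split=> [_ [[g ug <-]]|_ [g [ug sg] <-]].
  rewrite conj_hat_antiop ?unitr1// mulr1 => /antiop_inj gsg.
  by exists g => //; split=> //; rewrite -[RHS]mulr1 -gsg mulKr.
split; first by exists g.
by rewrite conj_hat_antiop ?unitr1// mulr1 sg mulrV.
Qed.

End Operators.

Theorem theorem4p2 (R : realType) (A : falgType R) (sigma : A -> A)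
    (semisimpleA : semisimple_algebra A)
    (sigma_anti : anti_involution sigma)
    (hermA : hermitian_algebra sigma)
    (standA : hermitian_standing_properties sigma) :
  matrix_group (hatG sigma) /\
  acts_on (hatG sigma) (CG sigma) (@conj_op R A) /\
  transitive_on (hatG sigma) (CG sigma) (@conj_op R A) /\
  CG sigma (@J0 R A) /\
  stabilizer (hatG sigma) (@conj_op R A) (@J0 R A) = hatK sigma.
Proof.
split; first exact: matrix_group_hatG.
split; first exact: acts_on_hatG.
split; first exact: transitive_on_hatG.
split; last exact: stabilizer_J0.
rewrite J0E -(expr1n _ 2); apply: antiop_CG => //; last exact: unitr1.
exact: sigma1.
Qed.
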